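(* The maximal number of disjoint Weyl group orbits on real roots in a hyperbolic root system is $4$. That is, for every hyperbolic Dynkin diagram the Weyl group has at most $4$ orbits on the set of real roots of the corresponding root system, and there is a hyperbolic Dynkin diagram for which the number of orbits is exactly $4$.
   Context: A generalized Cartan matrix is an integer matrix $A=(a_{ij})_{i,j=1,\dots,\ell}$ with $a_{ii}=2$, $a_{ij}\le 0$ for $i\ne j$, and $a_{ij}=0$ implies $a_{ji}=0$. Its Dynkin diagram is the graph on vertices $v_1,\dots,v_\ell$ in which $v_i,v_j$ ($i\neq j$) are joined by an edge iff $a_{ij}\neq 0$, each edge being decorated so as to record the pair $(a_{ij},a_{ji})$. A subdiagram is the diagram of a principal submatrix; it is proper if at least one vertex is deleted. A connected diagram is of finite type if all principal minors of its matrix are positive, and of affine type if all proper principal minors are positive and the determinant is $0$. A connected Dynkin diagram is hyperbolic if it is of neither finite nor affine type but every proper connected subdiagram is of finite or affine type. A hyperbolic root system is the Kac-Moody root system attached to a hyperbolic Dynkin diagram. Let $\alpha_1,\dots,\alpha_\ell$ be the simple roots, a basis of the free abelian group $\bigoplus_i\mathbb{Z}\alpha_i$. The Weyl group $W$ is generated by the simple reflections $w_i(\alpha_j)=\alpha_j-a_{ij}\alpha_i$. The real roots are the elements of $W\{\alpha_1,\dots,\alpha_\ell\}$. *)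

(* Defs.v *)
From HB Require Import structures.
From mathcomp Require Import all_boot all_order all_algebra.
From mathcomp Require Import classical_sets cardinality.

Set Implicit Arguments.
Unset Strict Implicit.
Unset Printing Implicit Defensive.

Import Order.TTheory GRing.Theory Num.Theory.
Local Open Scope ring_scope.

Definition gcm (n : nat) (A : 'M[int]_n) : Prop :=
  [/\ forall i, A i i = 2,
      forall i j, i != j -> A i j <= 0
    & forall i j, A i j = 0 -> A j i = 0].

(* The decoration of an edge records (A i j, A j i), so a Dynkin diagram and
   its matrix carry the same data; only the underlying graph is extracted. *)
Definition dynkin_edge (n : nat) (A : 'M[int]_n) : rel 'I_n :=
  [rel i j | (i != j) && (A i j != 0)].

Definition dynkin_connected (n : nat) (A : 'M[int]_n) : Prop :=
  (0 < n)%N /\ forall i j, connect (dynkin_edge A) i j.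

(* Principal submatrix on the vertices in S, relabelled by 'I_#|S|. *)
Definition principal_submx (n : nat) (A : 'M[int]_n) (S : {set 'I_n}) :
    'M[int]_#|S| :=
  mxsub enum_val enum_val A.

(* Both types are used only for connected diagrams; the minor on the empty
   set is 1, so including it in the quantification is harmless. *)
Definition finite_type (n : nat) (A : 'M[int]_n) : Prop :=
  forall S : {set 'I_n}, 0 < \det (principal_submx A S).

Definition affine_type (n : nat) (A : 'M[int]_n) : Prop :=
  (forall S : {set 'I_n},
     S \proper 'I_n -> 0 < \det (principal_submx A S)) /\
  \det A = 0.

Definition hyperbolic (n : nat) (A : 'M[int]_n) : Prop :=
  [/\ gcm A, dynkin_connected A, ~ finite_type A, ~ affine_type A
    & forall S : {set 'I_n}, S \proper 'I_n ->
        dynkin_connected (principal_submx A S) ->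
        finite_type (principal_submx A S) \/
        affine_type (principal_submx A S)].

(* The root lattice is 'cV[int]_n, in coordinates on the simple roots;
   matrices act on the left. *)
Definition simple_root (n : nat) (i : 'I_n) : 'cV[int]_n := delta_mx i 0.

Definition simple_reflection (n : nat) (A : 'M[int]_n) (i : 'I_n) : 'M[int]_n :=
  1%:M - simple_root i *m row i A.

Lemma simple_reflectionE (n : nat) (A : 'M[int]_n) (i j : 'I_n) :
  simple_reflection A i *m simple_root j =
  simple_root j - A i j *: simple_root i.
Proof.
rewrite /simple_reflection mulmxBl mul1mx -mulmxA; congr (_ - _).
rewrite /simple_root -colE -mul_mx_scalar; congr (_ *m _).
by apply/matrixP=> a b; rewrite !ord1 !mxE eqxx.
Qed.

Lemma simple_reflectionK (n : nat) (A : 'M[int]_n) (i : 'I_n) :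
  A i i = 2 -> simple_reflection A i *m simple_reflection A i = 1%:M.
Proof.
move=> Aii; rewrite {2}/simple_reflection mulmxBr mulmx1 mulmxA.
rewrite simple_reflectionE Aii scaler_nat mulr2n opprD addrA subrr sub0r.
by rewrite mulNmx opprK /simple_reflection subrK.
Qed.

(* The subgroup of GL_n(Z) generated by the simple reflections. *)
Inductive weyl (n : nat) (A : 'M[int]_n) : 'M[int]_n -> Prop :=
  | weyl_refl i : weyl A (simple_reflection A i)
  | weyl1 : weyl A 1%:M
  | weylM w1 w2 : weyl A w1 -> weyl A w2 -> weyl A (w1 *m w2)
  | weylV w : weyl A w -> weyl A (invmx w).

Local Open Scope classical_set_scope.

Definition real_roots (n : nat) (A : 'M[int]_n) : set 'cV[int]_n :=
  [set b | exists w i, weyl A w /\ b = w *m simple_root i].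

Definition weyl_orbit (n : nat) (A : 'M[int]_n) (b : 'cV[int]_n) :
    set 'cV[int]_n :=
  [set w *m b | w in [set w | weyl A w]].

Definition real_root_orbits (n : nat) (A : 'M[int]_n) :
    set (set 'cV[int]_n) :=
  [set weyl_orbit A b | b in real_roots A].

(* Main.v *)
Require Import Defs.
From mathcomp Require Import classical_sets cardinality.
From mathcomp Require Import all_boot all_order all_algebra.
From mathcomp Require Import zify ring.
From mathcomp Require Import perm.

Set Implicit Arguments.
Unset Strict Implicit.
Unset Printing Implicit Defensive.

Import Order.TTheory GRing.Theory Num.Theory.
Local Open Scope ring_scope.

(** If a_ij = a_ji = -1 then w_i w_j maps alpha_i to alpha_j, so the number of
orbits on real roots is at most the number of components of the graph of
simple edges ([simple_connect_orbit]).  It remains to bound the number of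
these components for a hyperbolic diagram, and this needs no classification:

- A connected diagram of finite or affine type has at most three simply laced
  components ([finite_or_affine_cover]).  With three components there is a path
  a, a', ..., b', b whose end edges are multiple and whose inner edges are
  simple.  Give the inner vertices the weight 2, and a and b the weights
  - a_aa' and - a_bb'.  This vector x >= 0 satisfies A x <= 0.  For finite or
  affine A such a vector has full support ([subharmonic_null]), so the path
  exhausts the diagram, whose components are therefore {a}, {b} and the inner
  vertices ([multiple_edges_cover]).

- A connected graph with at least two vertices has one whose deletion leaves it
  connected.  For a hyperbolic diagram the rest is of finite or affine type, so
  it has at most three components, and the deleted vertex adds at most one
  ([hyperbolic_cover]).

The property [subharmonic_null] comes straight from the principal minors: if
A x <= 0, the matrix diag(x) A - diag(A x), corrected by 1 on the diagonal
where x vanishes, kills x, while its determinant is a sum of nonnegative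
terms, one for each principal minor ([det_diag_pencil]), so all the terms
vanish.

The bound is attained by the star on four vertices whose three edges are
double, with the entries -2 in the row of the centre.  Modulo 2 its Weyl group
fixes every outer simple root and preserves the coefficient of the central
one, so no two simple roots are conjugate
([double_star_roots_disjoint]). *)

(** * Principal minors *)

(** The rows outside T are those of the identity.  This has the same determinant
as the principal submatrix on T, but the size does not depend on T. *)
Definition restrict_rows (R : nzRingType) (n : nat) (A : 'M[R]_n)
    (T : {set 'I_n}) : 'M[R]_n :=
  \matrix_(i, j) (if i \in T then A i j else (i == j)%:R).

Lemma det_mxsub_inj (R : comNzRingType) (p n : nat) (f : 'I_p -> 'I_n)
    (A : 'M[R]_n) :
  p = n -> injective f -> \det (mxsub f f A) = \det A.
Proof.
move=> epn; subst p => f_inj.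
have -> : mxsub f f A = row_perm (perm f_inj) (col_perm (perm f_inj) A).
  by apply/matrixP=> i j; rewrite !mxE !permE.
rewrite row_permE col_permE !det_mulmx det_perm det_perm odd_permV.
by rewrite mulrCA -signr_addb addbb mulr1.
Qed.

(** Order the indices with the image of f first: the matrix becomes block upper
triangular, with an identity block.  Taking f arbitrary also covers principal
minors of principal submatrices. *)
Lemma det_mxsub_image (R : comNzRingType) (m n : nat) (f : 'I_m -> 'I_n)
    (A : 'M[R]_n) :
  injective f ->
  \det (mxsub f f A) = \det (restrict_rows A [set f i | i in 'I_m]).
Proof.
move=> f_inj; set T := imset _ _.
have cardT : #|T| = m by rewrite card_imset // card_ord.
pose h (k : 'I_(m + #|~: T|)) : 'I_n :=
  match split k with inl i => f i | inr j => enum_val j end.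
have fT i : f i \in T by rewrite imset_f.
have eT (j : 'I_#|~: T|) : (enum_val j \in T) = false.
  by apply/negbTE; move: (enum_valP j); rewrite inE.
have h_inj : injective h.
  move=> k1 k2; rewrite /h => e.
  apply: (can_inj splitK); case: (split k1) (split k2) e => [i1|j1] [i2|j2].
  - by move=> /f_inj ->.
  - by move=> e; have := eT j2; rewrite -e fT.
  - by move=> e; have := eT j1; rewrite e fT.
  - by move=> /enum_val_inj ->.
have card_n : (m + #|~: T|)%N = n by rewrite -{1}cardT cardsC card_ord.
rewrite -(det_mxsub_inj (restrict_rows A T) card_n h_inj).
have -> : mxsub h h (restrict_rows A T) =
    block_mx (mxsub f f A) (\matrix_(i, j) A (f i) (enum_val j)) 0 1%:M.
  apply/matrixP=> k1 k2; rewrite -[k1]splitK -[k2]splitK.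
  case: (split k1) => [i1|j1]; case: (split k2) => [i2|j2];
    rewrite !mxE /h !unsplitK !(mxE, unsplitK).
  - by rewrite fT.
  - by rewrite fT.
  - rewrite eT; case: eqP => // e.
    by have := eT j1; rewrite e fT.
  - by rewrite eT (inj_eq enum_val_inj).
by rewrite det_ublock det1 mulr1.
Qed.

Lemma det_principal_submx (n : nat) (A : 'M[int]_n) (S : {set 'I_n}) :
  \det (principal_submx A S) = \det (restrict_rows A S).
Proof.
rewrite /principal_submx det_mxsub_image; last exact: enum_val_inj.
congr (\det (restrict_rows A _)); apply/setP=> i.
apply/imsetP/idP => [[j _ ->]|iS]; first exact: enum_valP.
by exists (enum_rank_in iS i); rewrite ?enum_rankK_in.
Qed.

Lemma restrict_rows_setT (n : nat) (A : 'M[int]_n) :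
  restrict_rows A [set: 'I_n] = A.
Proof. by apply/matrixP=> i j; rewrite !mxE in_setT. Qed.

(** Expand every row of diag c * A + diag d by multilinearity. *)
Lemma det_diag_pencil (R : comNzRingType) (n : nat) (A : 'M[R]_n)
    (c d : 'I_n -> R) :
  \det (\matrix_(i, j) (c i * A i j + d i * (i == j)%:R)) =
  \sum_(J : {set 'I_n})
     (\prod_i (if i \in J then c i else d i)) * \det (restrict_rows A J).
Proof.
under [RHS]eq_bigr => J _ do rewrite big_distrr /=.
rewrite [RHS]exchange_big /=; apply: eq_bigr => s _.
under eq_bigr => i _ do rewrite mxE.
rewrite bigA_distr big_distrr /=; apply: eq_big => // J _.
rewrite mulrCA; congr (_ * _); rewrite -big_split /=; apply: eq_bigr => i _.
by rewrite mxE; case: (i \in J).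
Qed.

Definition finite_or_affine (n : nat) (A : 'M[int]_n) : Prop :=
  finite_type A \/ affine_type A.

Lemma finite_or_affine_minors (n : nat) (A : 'M[int]_n) (T : {set 'I_n}) :
  finite_or_affine A ->
  0 <= \det (restrict_rows A T) /\
  (T != setT -> 0 < \det (restrict_rows A T)).
Proof.
case=> [finA|[posA detA]].
  by move: (finA T); rewrite det_principal_submx => gt0; split=> //; apply: ltW.
have [-> | TnT] := eqVneq T setT; first by rewrite restrict_rows_setT detA.
have := posA T; rewrite det_principal_submx properE => gt0.
suff lt0 : 0 < \det (restrict_rows A T) by split; rewrite // ltW.
apply: gt0; apply/andP; split; first by apply/subsetP.
apply: contra TnT => /subsetP sub.
by apply/eqP/setP=> i; rewrite in_setT; apply: sub.
Qed.

(** In finite type this excludes such an x, since A is invertible; in affine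
type it forces x to be a positive null vector. *)
Lemma subharmonic_null (n : nat) (A : 'M[int]_n) (x : 'cV[int]_n) :
  finite_or_affine A ->
  (forall i, 0 <= x i 0) -> x != 0 -> (forall i, (A *m x) i 0 <= 0) ->
  (forall i, x i 0 != 0) /\ A *m x = 0.
Proof.
move=> typA x_ge0 x_neq0 Ax_le0.
pose c i := x i 0; pose d i := (c i == 0)%:R - (A *m x) i 0.
have d_ge0 i : 0 <= d i by rewrite /d; have := Ax_le0 i; case: eqP => _ /=; lia.
(* N x = 0: in row i the diagonal term cancels x i * (A x) i, and the
   correction of d i by 1 is present only when x i = 0.  It makes d i positive
   there, which is what excludes a proper support below. *)
pose N := \matrix_(i, j) (c i * A i j + d i * (i == j)%:R).
have Nx0 : N *m x = 0.
  apply/matrixP=> i j; rewrite ord1 !mxE.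
  under eq_bigr => k _ do rewrite mxE mulrDl -mulrA.
  rewrite big_split -big_distrr /= [X in _ + X](bigD1 i) //=.
  rewrite [X in _ + (_ + X)]big1 => [|k ki].
    rewrite eqxx mulr1 addr0 /d mxE -/(c i); case: eqP => [->|_] /=; last by ring.
    by rewrite !mul0r mulr0 addr0.
  by rewrite eq_sym (negbTE ki) mulr0 mul0r.
have detN : \det N = 0.
  apply/eqP; rewrite -det_tr; apply/det0P; exists x^T.
    by rewrite -trmx0 (inj_eq trmx_inj).
  by rewrite -trmx_mul Nx0 trmx0.
pose term (J : {set 'I_n}) :=
  (\prod_i (if i \in J then c i else d i)) * \det (restrict_rows A J).
have term0 J : term J = 0.
  move: detN; rewrite det_diag_pencil => /eqP; rewrite psumr_eq0.
    by move=> /allP/(_ J)/[!mem_index_enum]/(_ isT)/eqP.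
  move=> K _; apply: mulr_ge0; last by case: (finite_or_affine_minors K typA).
  by apply: prodr_ge0 => i _; case: ifP => _ //; apply: x_ge0.
have factor0 (J : {set 'I_n}) : J != setT ->
    exists2 i, true & (if i \in J then c i else d i) == 0.
  move=> JnT; have /eqP := term0 J; rewrite /term mulf_eq0.
  have [_ /(_ JnT) gt0] := finite_or_affine_minors J typA.
  by rewrite (gt_eqF gt0) orbF => /prodf_eq0.
have c_neq0 i : c i != 0.
  (* On the term of the support of x, every factor c or d is nonzero. *)
  apply/negP=> ci0; have : [set k | c k != 0] != setT.
    by apply/eqP=> /setP/(_ i); rewrite !inE ci0.
  case/factor0=> k _; rewrite inE /d; case: (c k =P 0) => [_|ne] /= /eqP //.
  by move/subr0_eq=> e; have := Ax_le0 k; rewrite -e.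
split=> //; apply/matrixP=> i j; rewrite ord1 [RHS]mxE.
(* The term omitting only i isolates the factor d i = - (A x) i. *)
have : [set~ i] != setT by apply/eqP=> /setP/(_ i); rewrite !inE eqxx.
case/factor0=> k _; rewrite !inE; have [-> | _] := eqVneq k i; rewrite /=.
  by rewrite /d (negbTE (c_neq0 i)) sub0r oppr_eq0 => /eqP.
by rewrite (negbTE (c_neq0 k)).
Qed.

(** * Simply laced components *)

Definition simple_edge (n : nat) (A : 'M[int]_n) : rel 'I_n :=
  [rel i j | (A i j == -1) && (A j i == -1)].

Definition simple_cover (n : nat) (A : 'M[int]_n) (t : seq 'I_n) : Prop :=
  forall v, exists2 u, u \in t & connect (simple_edge A) u v.

Lemma connect_exit (T : finType) (e : rel T) (P : pred T) (x y : T) :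
  connect e x y -> P x -> ~~ P y -> exists u w, [/\ P u, ~~ P w & e u w].
Proof.
case/connectP=> p; elim: p x => [|z p IHp] x /=; first by move=> _ -> ->.
case/andP=> exz ezp yE Px nPy; case: (boolP (P z)) => [Pz | nPz].
  exact: (IHp z).
by exists x, z.
Qed.

Lemma simple_edge_sym (n : nat) (A : 'M[int]_n) : symmetric (simple_edge A).
Proof. by move=> i j; apply: andbC. Qed.

Lemma simple_connect_sym (n : nat) (A : 'M[int]_n) :
  connect_sym (simple_edge A).
Proof. by apply/sym_connect_sym/simple_edge_sym. Qed.

Lemma dynkin_edge_sym (n : nat) (A : 'M[int]_n) :
  gcm A -> symmetric (dynkin_edge A).
Proof.
case=> _ _ A0 i j; rewrite /dynkin_edge /= eq_sym; congr (_ && ~~ _).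
by apply/eqP/eqP; apply: A0.
Qed.

Lemma gcm_edge_lt0 (n : nat) (A : 'M[int]_n) (i j : 'I_n) :
  gcm A -> dynkin_edge A i j -> A i j < 0.
Proof.
by case=> _ Ale0 _ /andP[ij Aij]; rewrite lt_neqAle Aij Ale0.
Qed.

Lemma multiple_edge_ge2 (n : nat) (A : 'M[int]_n) (i j : 'I_n) :
  gcm A -> dynkin_edge A i j -> ~~ simple_edge A i j -> 2 <= A i j * A j i.
Proof.
move=> gA eij; rewrite /simple_edge /=.
have lt1 := gcm_edge_lt0 gA eij.
have lt2 : A j i < 0 by apply: gcm_edge_lt0; rewrite // dynkin_edge_sym.
by move: lt1 lt2; case: eqP => [->|?]; case: eqP => [->|?] //; nia.
Qed.

(** Dropping off-diagonal terms can only increase a row of A x when x >= 0. *)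
Lemma gcm_row_le (n : nat) (A : 'M[int]_n) (x : 'cV[int]_n) (i : 'I_n)
    (t : seq 'I_n) :
  gcm A -> (forall k, 0 <= x k 0) -> uniq (i :: t) ->
  (A *m x) i 0 <= 2 * x i 0 + \sum_(k <- t) A i k * x k 0.
Proof.
case=> Aii Ale0 _ x_ge0 /[dup] uit /andP[it ut].
rewrite mxE (bigID (mem (i :: t))) /= -big_uniq // big_cons Aii.
rewrite -[leRHS]addr0 lerD2l; apply: sumr_le0 => k.
rewrite inE negb_or => /andP[ki _]; apply: mulr_le0_ge0 => //.
by apply: Ale0; rewrite eq_sym.
Qed.

(** Such an edge is necessarily multiple. *)
Definition exit_edge (n : nat) (A : 'M[int]_n) : rel 'I_n :=
  [rel u w | dynkin_edge A u w && ~~ connect (simple_edge A) u w].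

(** Contract the simply laced components: a connected graph with at least three
vertices has one with two neighbours.  An edge leaves the component of v1, and
a third component is reached from one of its two ends. *)
Lemma component_two_exits (n : nat) (A : 'M[int]_n) (v1 v2 v3 : 'I_n) :
  gcm A -> dynkin_connected A ->
  ~~ connect (simple_edge A) v1 v2 -> ~~ connect (simple_edge A) v1 v3 ->
  ~~ connect (simple_edge A) v2 v3 ->
  exists a b a' b',
    [/\ a != b, exit_edge A a' a, exit_edge A b' b
      & connect (simple_edge A) a' b'].
Proof.
move=> gA [_ conA] n12 n13 n23; set s := connect _ in n12 n13 n23 *.
have sC : symmetric s by apply: simple_connect_sym.
have sT : transitive s by apply: connect_trans.
have eC := dynkin_edge_sym gA.
have [u [w [v1u nv1w euw]]] := connect_exit (conA v1 v2) (connect0 _ v1) n12.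
have [z nv1z nwz] : exists2 z, ~~ (s v1 z) & ~~ (s w z).
  case: (boolP (s w v2)) => [wv2 | nwv2]; last by exists v2.
  exists v3 => //; apply: contra n23 => wv3; apply: sT wv3.
  by rewrite sC.
have nuw : ~~ s u w by apply: contra nv1w; apply: sT.
have nuz : ~~ s u z by apply: contra nv1z; apply: sT.
pose P := [pred k | s u k || s w k].
have Pu : P u by rewrite /= /s connect0.
have nPz : ~~ P z by rewrite /= negb_or nuz.
have [u' [z' [Pu' nPz' eu'z']]] := connect_exit (conA u z) Pu nPz.
move: nPz'; rewrite /= negb_or => /andP[nuz' nwz'].
case/orP: Pu' => [uu' | wu'].
- exists w, z', u, u'; split=> //.
  + by apply: contra nwz' => /eqP->; apply: connect0.
  + by apply/andP.
  + by apply/andP; split=> //; apply: contra nuz'; apply: sT.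
- exists u, z', w, u'; split=> //.
  + by apply: contra nuz' => /eqP->; apply: connect0.
  + by rewrite /exit_edge /= eC euw simple_connect_sym.
  + by apply/andP; split=> //; apply: contra nwz'; apply: sT.
Qed.

(** Along a path inside the component of a' and b' every vertex has two
neighbours in the support of x, each contributing at most -2 to its row and
so compensating the diagonal 2 * 2.  At a' and b' one of these contributions
is the product of the two entries of a multiple edge. *)
Lemma multiple_edges_cover (n : nat) (A : 'M[int]_n) (a b a' b' : 'I_n) :
  gcm A -> finite_or_affine A ->
  a != b -> exit_edge A a' a -> exit_edge A b' b ->
  connect (simple_edge A) a' b' ->
  simple_cover A [:: a; b; a'].
Proof.
move=> gA typA ab /andP[ea'a naa] /andP[eb'b nbb] cab'.
have nab : ~~ connect (simple_edge A) a' b.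
  apply: contra nbb; apply: connect_trans.
  by rewrite simple_connect_sym.
have eaa' : dynkin_edge A a a' by rewrite dynkin_edge_sym.
have ebb' : dynkin_edge A b b' by rewrite dynkin_edge_sym.
have [p0 p0path p0last] := connectP cab'.
case/shortenP: p0path p0last => p pP pU _ b'E {p0}.
set q := a' :: p in pU.
have q_con v : v \in q -> connect (simple_edge A) a' v.
  by move=> vq; apply: (path_connect pP).
have aNq : a \notin q by apply: contra naa; apply: q_con.
have bNq : b \notin q by apply: contra nab; apply: q_con.
pose x : 'cV[int]_n := \col_v
  (if v == a then - A a a' else if v == b then - A b b'
   else if v \in q then 2 else 0).
have xa : x a 0 = - A a a' by rewrite mxE eqxx.
have xb : x b 0 = - A b b' by rewrite mxE eq_sym (negbTE ab) eqxx.
have xq v : v \in q -> x v 0 = 2.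
  move=> vq; rewrite mxE; case: eqP => [va|_]; first by rewrite -va vq in aNq.
  by case: eqP => [vb|_]; [rewrite -vb vq in bNq | rewrite vq].
have lta := gcm_edge_lt0 gA eaa'; have ltb := gcm_edge_lt0 gA ebb'.
have x_ge0 v : 0 <= x v 0.
  by rewrite mxE; do 2?[case: ifP => _; first by rewrite oppr_ge0 ltW]; case: ifP.
have a'q : a' \in q by apply: mem_head.
have b'q : b' \in q by rewrite b'E mem_last.
have Ax_le0 v : (A *m x) v 0 <= 0.
  have [-> | va] := eqVneq v a.
    have ua : uniq [:: a; a'] by rewrite /= inE andbT; case/andP: eaa'.
    have := gcm_row_le gA x_ge0 ua; rewrite big_seq1 xa (xq a') //.
    by move/le_trans; apply; rewrite mulrN mulrC addNr.
  have [-> | vb] := eqVneq v b.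
    have ub : uniq [:: b; b'] by rewrite /= inE andbT; case/andP: ebb'.
    have := gcm_row_le gA x_ge0 ub; rewrite big_seq1 xb (xq b') //.
    by move/le_trans; apply; rewrite mulrN mulrC addNr.
  case: (boolP (v \in q)) => [vq | vNq]; last first.
    have uv : uniq [:: v] by [].
    have := gcm_row_le gA x_ge0 uv.
    by rewrite big_nil [x v 0]mxE (negbTE va) (negbTE vb) (negbTE vNq).
  have lt_v : (index v q < size q)%N by rewrite index_mem.
  have steps := pathP v pP.
  have [u1 le1 u1P] : exists2 u1, A v u1 * x u1 0 <= -2 &
      u1 = a \/ u1 \in q /\ (index u1 q < index v q)%N.
    have [iv0 | iv_gt0] := posnP (index v q).
      have -> : v = a' by rewrite -(nth_index v vq) iv0.
      exists a; last by left.
      have := multiple_edge_ge2 gA eaa'; rewrite simple_edge_sym.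
      move/(_ (contra (@connect1 _ _ _ _) naa)); rewrite xa; clear; lia.
    pose u1 := nth v q (index v q).-1.
    have lt_u1 : ((index v q).-1 < size q)%N.
      exact: leq_ltn_trans (leq_pred _) lt_v.
    have u1q : u1 \in q by rewrite mem_nth.
    have iu1 : index u1 q = (index v q).-1 by rewrite index_uniq.
    exists u1; last by right; rewrite iu1 prednK.
    have lt_u1p : ((index v q).-1 < size p)%N by rewrite -ltnS prednK.
    have /andP[_ /eqP] := steps _ lt_u1p.
    have -> : nth v p (index v q).-1 = v.
      by have := nth_index v vq; rewrite -{1}(prednK iv_gt0).
    by rewrite -/q -/u1 => ->; rewrite xq.
  have [u2 le2 u2P] : exists2 u2, A v u2 * x u2 0 <= -2 &
      u2 = b \/ u2 \in q /\ (index v q < index u2 q)%N.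
    have [ivp | iv_lt] := eqVneq (index v q) (size p).
      have -> : v = b' by rewrite -(nth_index v vq) ivp b'E (last_nth v).
      exists b; last by left.
      have := multiple_edge_ge2 gA ebb'; rewrite simple_edge_sym.
      move/(_ (contra (@connect1 _ _ _ _) nbb)); rewrite xb; clear; lia.
    pose u2 := nth v q (index v q).+1.
    have lt_u2 : ((index v q).+1 < size q)%N.
      by rewrite ltnS ltn_neqAle iv_lt -ltnS.
    have u2q : u2 \in q by rewrite mem_nth.
    have iu2 : index u2 q = (index v q).+1 by rewrite index_uniq.
    exists u2; last by right; rewrite iu2.
    have /andP[/eqP] := steps _ (lt_u2 : (index v q < size p)%N).
    by rewrite -/q nth_index // => Avu _; rewrite xq // /u2 /= Avu.
  have uniq3 : uniq [:: v; u1; u2].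
    rewrite /= !inE negb_or andbT; apply/andP; split; first (apply/andP; split).
    - by case: u1P => [-> // | [_ lt1]]; apply: contraTneq lt1 => ->; rewrite ltnn.
    - by case: u2P => [-> // | [_ lt2]]; apply: contraTneq lt2 => ->; rewrite ltnn.
    - case: u1P u2P => [-> | [u1q lt1]] [-> // | [u2q lt2]].
      + by apply: contraNneq aNq => ->.
      + by apply: contraNneq bNq => <-.
      + by apply: contraTneq lt1 => ->; rewrite -leqNgt ltnW.
  have := gcm_row_le gA x_ge0 uniq3; rewrite !big_cons big_nil (xq v) //.
  by move/le_trans; apply; move: le1 le2; clear; lia.
have x_neq0 : x != 0.
  by apply/eqP=> /matrixP/(_ a' 0); rewrite xq // mxE.
have [x_supp _] := subharmonic_null typA x_ge0 x_neq0 Ax_le0.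
move=> v; have := x_supp v; rewrite mxE; case: (v =P a) => [->|_].
  by exists a; rewrite ?connect0 // !inE eqxx.
case: (v =P b) => [-> _|_]; first by exists b; rewrite ?connect0 // !inE eqxx orbT.
case: ifP => // vq _; exists a'; last exact: q_con.
by rewrite !inE eqxx !orbT.
Qed.

Lemma finite_or_affine_cover (n : nat) (A : 'M[int]_n) :
  gcm A -> dynkin_connected A -> finite_or_affine A ->
  exists2 t, (size t <= 3)%N & simple_cover A t.
Proof.
move=> gA conA typA; have [n_gt0 _] := conA; pose v1 := Ordinal n_gt0.
set s := connect (simple_edge A).
case: (pickP [pred v | ~~ s v1 v]) => [v2 /= n12 | cov1]; last first.
  exists [:: v1] => // v; exists v1; rewrite ?mem_head //.
  by have /negbFE := cov1 v.
case: (pickP [pred v | ~~ s v1 v && ~~ s v2 v]) => [v3 /andP[n13 n23] | cov2].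
  have [a [b [a' [b' [ab ea eb cab]]]]] :=
    component_two_exits gA conA n12 n13 n23.
  exists [:: a; b; a'] => //; exact: (@multiple_edges_cover _ _ a b a' b').
exists [:: v1; v2] => // v; have := cov2 v.
rewrite /= -negb_or => /negbFE/orP[v1v | v2v].
  by exists v1; rewrite ?mem_head.
by exists v2; rewrite // !inE eqxx orbT.
Qed.

(** * Deleting a vertex from a hyperbolic diagram *)

Definition induced_rel (T : finType) (e : rel T) (S : {set T}) : rel T :=
  [rel i j | [&& i \in S, j \in S & e i j]].

(** Grow the set one vertex at a time; for k one less than the number of
vertices it is the complement of a non-cut vertex. *)
Lemma connected_subset (T : finType) (e : rel T) (k : nat) :
  symmetric e -> (forall i j, connect e i j) -> (0 < k <= #|T|)%N ->
  exists2 S : {set T}, #|S| = k &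
    {in S &, forall i j, connect (induced_rel e S) i j}.
Proof.
move=> eC econ; elim: k => // [[|k]] IHk /= ltkT.
  have [r _] := card_gt0P ltkT; exists [set r]; first by rewrite cards1.
  by move=> i j /set1P-> /set1P->; apply: connect0.
have [|S cardS conS] := IHk; first exact: ltnW.
have [r rS] : exists r, r \in S by apply/set0Pn; rewrite -card_gt0 cardS.
have [z zS] : exists z, z \notin S.
  apply/existsP; rewrite -negb_forall; apply: contraTN ltkT => /forallP Sall.
  rewrite -leqNgt -cardS; apply/subset_leq_card/subsetP=> i _.
  exact: Sall.
have [u [w [uS wS euw]]] : exists u w, [/\ u \in S, w \notin S & e u w].
  exact: connect_exit (econ r z) rS zS.
exists (w |: S); first by rewrite cardsU1 wS cardS.
set S' := w |: S.
have con_u i : i \in S' -> connect (induced_rel e S') u i.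
  case/setU1P=> [->|iS].
    by apply: connect1; rewrite /induced_rel /= !in_setU1 uS eqxx orbT euw.
  apply: connect_sub (conS _ _ uS iS) => i1 i2 /and3P[i1S i2S e12].
  by apply: connect1; rewrite /induced_rel /= !in_setU1 i1S i2S !orbT.
have symS' : connect_sym (induced_rel e S').
  by apply: sym_connect_sym => i j; rewrite /induced_rel /= eC andbCA.
by move=> i j iS jS; apply: connect_trans (con_u j jS); rewrite symS' con_u.
Qed.

Lemma principal_submx_connected (n : nat) (A : 'M[int]_n) (S : {set 'I_n}) :
  (0 < #|S|)%N ->
  {in S &, forall i j, connect (induced_rel (dynkin_edge A) S) i j} ->
  dynkin_connected (principal_submx A S).
Proof.
move=> S_gt0 conS; split=> // i j; set e := dynkin_edge _.
pose P v := [exists k, (enum_val k == v) && connect e i k].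
apply/negPn/negP=> nij.
have Pi : P (enum_val i) by apply/existsP; exists i; rewrite eqxx connect0.
have nPj : ~~ P (enum_val j).
  apply: contra nij => /existsP[k /andP[/eqP/enum_val_inj-> //]].
have [u [w [/existsP[k /andP[/eqP ku cik]] nPw]]] :=
  connect_exit (conS _ _ (enum_valP i) (enum_valP j)) Pi nPj.
case/and3P=> uS wS euw; case/negP: nPw; apply/existsP.
exists (enum_rank_in wS w); rewrite enum_rankK_in // eqxx /=.
apply: connect_trans cik (connect1 _).
rewrite /e /dynkin_edge /= mxE enum_rankK_in // ku.
case/andP: euw => uw ->; rewrite andbT; apply: contraNneq uw => kw.
by rewrite -ku kw enum_rankK_in.
Qed.

Lemma principal_submx_gcm (n : nat) (A : 'M[int]_n) (S : {set 'I_n}) :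
  gcm A -> gcm (principal_submx A S).
Proof.
case=> Aii Ale0 A0; split=> [i|i j ij|i j]; rewrite !mxE; first exact: Aii.
  by apply: Ale0; rewrite (inj_eq enum_val_inj).
exact: A0.
Qed.

Lemma simple_cover_lift (n : nat) (A : 'M[int]_n) (S : {set 'I_n})
    (t : seq 'I_#|S|) (v : 'I_n) :
  simple_cover (principal_submx A S) t -> v \in S ->
  exists2 u, u \in map enum_val t & connect (simple_edge A) u v.
Proof.
move=> cov vS; have [k kt ck] := cov (enum_rank_in vS v).
exists (enum_val k); first exact: map_f.
rewrite -[v](enum_rankK_in vS vS); apply/negPn/negP=> nkv.
pose P := [pred j : 'I_#|S| | connect (simple_edge A) (enum_val k) (enum_val j)].
have [i [j [Pi nPj]]] := connect_exit (P := P) ck (connect0 _ _) nkv.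
rewrite {1}/simple_edge /= !mxE => eij; case/negP: nPj.
by apply: connect_trans Pi (connect1 _).
Qed.

Lemma hyperbolic_cover (n : nat) (A : 'M[int]_n) :
  hyperbolic A -> exists2 t, (size t <= 4)%N & simple_cover A t.
Proof.
case=> gA conA _ _ properA; have [n_gt0 econ] := conA.
have [n_le1 | n_gt1] := leqP n 1.
  exists (enum 'I_n); first by rewrite size_enum_ord; apply: leq_trans n_le1 _.
  by move=> v; exists v; rewrite ?mem_enum.
have [|S cardS conS] :=
    connected_subset (k := n.-1) (dynkin_edge_sym gA) econ.
  by rewrite card_ord leq_pred andbT -ltnS prednK.
have S_gt0 : (0 < #|S|)%N by rewrite cardS -ltnS prednK.
have cardSC : #|~: S| = 1%N.
  apply/eqP; rewrite -(eqn_add2l #|S|) cardsC card_ord cardS addn1.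
  by rewrite prednK.
have /eqP/cards1P[z SC] := cardSC.
have S_proper : S \proper 'I_n.
  apply/properP; split; first exact/subsetP.
  by exists z => //; rewrite -in_setC SC set11.
have conB := principal_submx_connected S_gt0 conS.
have [t t_le cov] := finite_or_affine_cover (principal_submx_gcm S gA) conB
  (properA S S_proper conB).
exists (z :: map enum_val t); first by rewrite /= size_map.
move=> v; case: (boolP (v \in S)) => [vS | vNS].
  have [u ut cuv] := simple_cover_lift cov vS.
  by exists u => //; rewrite inE ut orbT.
exists v; last exact: connect0.
by rewrite -in_setC SC in vNS; rewrite (set1P vNS) mem_head.
Qed.

(** * Orbits of real roots *)

(** Reflections are involutions, so closure under products alone suffices. *)
Lemma weyl_group_ind (n : nat) (A : 'M[int]_n) (P : 'M[int]_n -> Prop) :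
  gcm A -> P 1%:M -> (forall i, P (simple_reflection A i)) ->
  (forall w1 w2, P w1 -> P w2 -> P (w1 *m w2)) ->
  forall w, weyl A w -> w \in unitmx /\ P w.
Proof.
case=> Aii _ _ P1 Prefl PM.
have reflV i : simple_reflection A i \in unitmx /\
    invmx (simple_reflection A i) = simple_reflection A i.
  have rr := simple_reflectionK (Aii i); have [u _] := mulmx1_unit rr.
  by split=> //; rewrite -[RHS](mulKmx u) rr mulmx1.
suff all w : weyl A w -> [/\ w \in unitmx, P w & P (invmx w)].
  by move=> w /all[].
elim=> [i||w1 w2 _ [u1 p1 q1] _ [u2 p2 q2]|w1 _ [u1 p1 q1]].
- by have [u ->] := reflV i; split.
- by rewrite invmx1 unitmx1.
- have u12 : w1 *m w2 \in unitmx by rewrite unitmx_mul u1 u2.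
  have -> : invmx (w1 *m w2) = invmx w2 *m invmx w1.
    apply: (can_inj (mulKmx u12)).
    by rewrite mulmxV // -mulmxA [w2 *m _]mulmxA mulmxV // mul1mx mulmxV.
  by split; [| apply: PM | apply: PM].
- by rewrite unitmx_inv invmxK.
Qed.

Lemma weyl_unitmx (n : nat) (A : 'M[int]_n) (w : 'M[int]_n) :
  gcm A -> weyl A w -> w \in unitmx.
Proof.
by move=> gA /(@weyl_group_ind _ _ (fun=> True) gA I); case.
Qed.

Lemma weyl_orbit_mulmx (n : nat) (A w : 'M[int]_n) (b : 'cV[int]_n) :
  gcm A -> weyl A w -> weyl_orbit A (w *m b) = weyl_orbit A b.
Proof.
move=> gA Ww; have uw := weyl_unitmx gA Ww.
rewrite /weyl_orbit; apply/seteqP; split=> _ [w' Ww' <-] /=.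
  by exists (w' *m w); [apply: weylM | rewrite mulmxA].
exists (w' *m invmx w); first by apply: weylM => //; apply: weylV.
by rewrite -mulmxA mulKmx.
Qed.

(** The element w_i w_j of the Weyl group maps alpha_i to alpha_j. *)
Lemma simple_edge_orbit (n : nat) (A : 'M[int]_n) (i j : 'I_n) :
  gcm A -> simple_edge A i j ->
  weyl_orbit A (simple_root i) = weyl_orbit A (simple_root j).
Proof.
move=> gA; have [Aii _ _] := gA => /andP[/eqP Aij /eqP Aji].
have W : weyl A (simple_reflection A i *m simple_reflection A j).
  by apply: weylM; apply: weyl_refl.
rewrite -(weyl_orbit_mulmx _ gA W) -mulmxA simple_reflectionE Aji scaleN1r.
rewrite opprK mulmxDr !simple_reflectionE Aii Aij scaleN1r opprK.
by rewrite scaler_nat mulr2n opprD [X in X + _]addrA subrr sub0r addrCA addNr addr0.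
Qed.

Lemma simple_connect_orbit (n : nat) (A : 'M[int]_n) (i j : 'I_n) :
  gcm A -> connect (simple_edge A) i j ->
  weyl_orbit A (simple_root i) = weyl_orbit A (simple_root j).
Proof.
move=> gA /connectP[p]; elim: p i => [|k p IHp] i /=; first by move=> _ ->.
by case/andP=> /(simple_edge_orbit gA)-> kp jE; apply: IHp.
Qed.

Lemma hyperbolic_orbits_le4 (n : nat) (A : 'M[int]_n) :
  hyperbolic A -> (real_root_orbits A #<= `I_4)%card.
Proof.
move=> hA; have [gA [n_gt0 _] _ _ _] := hA.
have [t t_le cov] := hyperbolic_cover hA.
pose f k := weyl_orbit A (simple_root (nth (Ordinal n_gt0) t k)).
apply: card_le_trans (card_image_le f `I_4); apply: subset_card_le.
move=> _ [_ [w [i [Ww ->]]] <-]; have [u ut cui] := cov i.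
exists (index u t); first by rewrite /= (leq_trans _ t_le) // index_mem.
by rewrite /f nth_index // (simple_connect_orbit gA cui) weyl_orbit_mulmx.
Qed.

(** * A hyperbolic diagram with four orbits *)

(** The centre is vertex 0.  Two leaves and the centre form an affine diagram,
and all smaller subdiagrams are of finite type. *)
Definition double_star : 'M[int]_4 :=
  \matrix_(i < 4, j < 4)
    if i == j then 2 else if i == ord0 then -2
    else if j == ord0 then -1 else 0.

Lemma det_arrow (R : comNzRingType) (r c d : nat -> R) :
  \det (\matrix_(i < 4, j < 4)
    (if i == j then d i else if i == 0 :> nat then r j
     else if j == 0 :> nat then c i else 0)) =
  d 0%N * d 1%N * d 2 * d 3 - r 1%N * c 1%N * d 2 * d 3
  - r 2 * c 2 * d 1%N * d 3 - r 3 * c 3 * d 1%N * d 2.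
Proof.
rewrite (expand_det_row _ ord0) !big_ord_recl big_ord0 /cofactor.
do 2!rewrite !(expand_det_row _ ord0) !big_ord_recl !big_ord0 /cofactor.
rewrite !det_mx11 !mxE -!val_eqE /= /bump /=.
by ring.
Qed.

(** A set of k vertices has minor 2 ^ (k - 1) * (3 - k) if it contains the
centre, and 2 ^ k otherwise. *)
Lemma double_star_minor (T : {set 'I_4}) :
  ((#|T| <= 3)%N -> 0 <= \det (restrict_rows double_star T)) /\
  ((#|T| <= 2)%N -> 0 < \det (restrict_rows double_star T)).
Proof.
pose m k : bool := inord k \in T.
have mE (i : 'I_4) : (i \in T) = m i by rewrite /m inord_val.
have -> : #|T| = (m 0 + m 1 + m 2 + m 3)%N.
  rewrite -sum1_card big_mkcond !big_ord_recl big_ord0 !mE /=.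
  by case: (m 0) (m 1) (m 2) (m 3) => [] [] [] [].
pose r (_ : nat) : int := if m 0 then -2 else 0.
pose c k : int := if m k then -1 else 0.
pose d k : int := if m k then 2 else 1.
have -> : restrict_rows double_star T = \matrix_(i < 4, j < 4)
    (if i == j then d i else if i == 0 :> nat then r j
     else if j == 0 :> nat then c i else 0).
  apply/matrixP=> i j; rewrite !mxE mE /r /c /d -![_ == ord0]val_eqE /=.
  case: (i =P j) => _; first by case: (m i).
  case: eqP => [-> | _]; first by case: (m 0).
  by case: eqP => _; case: (m i).
rewrite (det_arrow r c d) /r /c /d.
by case: (m 0) (m 1) (m 2) (m 3) => [] [] [] [].
Qed.

Lemma double_star_gcm : gcm double_star.
Proof.
split=> [i|i j ij|i j]; rewrite !mxE ?eqxx // eq_sym.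
  by rewrite eq_sym (negbTE ij); do 2?case: ifP.
by do 3?case: ifP.
Qed.

Lemma double_star_submx (S : {set 'I_4}) :
  S \proper 'I_4 -> finite_or_affine (principal_submx double_star S).
Proof.
move=> S_proper; set B := principal_submx _ S.
have minorE (U : {set 'I_#|S|}) : \det (principal_submx B U) =
    \det (restrict_rows double_star [set enum_val i | i in U]).
  have inj := inj_comp (@enum_val_inj _ (mem S)) (@enum_val_inj _ (mem U)).
  rewrite /B /principal_submx -mxsub_comp det_mxsub_image //.
  congr (\det (restrict_rows _ _)); apply/setP=> v.
  apply/imsetP/imsetP => [[k _ ->] | [i iU ->]].
    by exists (enum_val k) => //; apply: enum_valP.
  by exists (enum_rank_in iU i) => //=; rewrite enum_rankK_in.
have cardU (U : {set 'I_#|S|}) : #|[set enum_val i | i in U]| = #|U|.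
  by rewrite card_imset //; apply: enum_val_inj.
have S_le3 : (#|S| <= 3)%N by have := proper_card S_proper; rewrite card_ord.
have B_proper (U : {set 'I_#|S|}) : U \proper 'I_#|S| ->
    0 < \det (principal_submx B U).
  move=> /proper_card; rewrite card_ord => ltUS; rewrite minorE.
  apply: (double_star_minor _).2; rewrite cardU -ltnS.
  exact: leq_trans ltUS S_le3.
have : 0 <= \det B by rewrite det_principal_submx (double_star_minor S).1.
rewrite le_eqVlt => /orP[/eqP detB | detB]; first by right.
left=> U; have [/B_proper // | ] := boolP (U \proper 'I_#|S|).
move=> UnP; have -> : U = setT.
  apply/eqP; apply: contraR UnP => UnT; rewrite -properT in UnT.
  by apply: proper_sub_trans UnT _; apply/subsetP.
by rewrite det_principal_submx restrict_rows_setT.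
Qed.

Lemma double_star_hyperbolic : hyperbolic double_star.
Proof.
have det_lt0 : \det double_star = -8.
  pose c (a : int) (_ : nat) := a.
  have -> : double_star = \matrix_(i < 4, j < 4)
      (if i == j then c 2 i else if i == 0 :> nat then c (-2) j
       else if j == 0 :> nat then c (-1) i else 0).
    by apply/matrixP=> i j; rewrite !mxE /c -!val_eqE.
  by rewrite (det_arrow (c (-2)) (c (-1)) (c 2)).
split.
- exact: double_star_gcm.
- have con0 i : connect (dynkin_edge double_star) ord0 i.
    have [-> // | i0] := eqVneq i ord0.
    by apply: connect1; rewrite /dynkin_edge /= mxE [ord0 == i]eq_sym (negbTE i0).
  split=> // i j; apply: connect_trans (con0 j).
  by rewrite (sym_connect_sym (dynkin_edge_sym double_star_gcm)) con0.
- by move/(_ setT); rewrite det_principal_submx restrict_rows_setT det_lt0.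
- by case=> _; rewrite det_lt0.
- by move=> S S_proper _; apply: double_star_submx.
Qed.

Definition mod2 (w : 'M[int]_4) : 'M['F_2]_4 := map_mx intr w.

(** Modulo 2 such a matrix differs from the identity only in the column of the
centre, below its diagonal entry. *)
Definition fixes_mod2 (w : 'M[int]_4) : Prop :=
  (forall k, k != ord0 -> mod2 w *m delta_mx k 0 = delta_mx k 0 :> 'cV_4) /\
  delta_mx 0 ord0 *m mod2 w = delta_mx 0 ord0 :> 'rV_4.

(** The row of the centre, and all columns but that of the centre, are even in
the Cartan matrix. *)
Lemma double_star_weyl_mod2 (w : 'M[int]_4) :
  weyl double_star w -> fixes_mod2 w.
Proof.
move=> Ww.
have [] // := weyl_group_ind (P := fixes_mod2) double_star_gcm _ _ _ Ww.
- by rewrite /fixes_mod2 /mod2 map_mx1 mulmx1; split=> // k _; rewrite mul1mx.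
- move=> i; have reflE a b : mod2 (simple_reflection double_star i) a b =
      (a == b)%:R - (a == i)%:R * (double_star i b)%:~R.
    by rewrite !mxE big_ord1 !mxE eqxx andbT rmorphB rmorphM /= !rmorph_nat.
  have even b : (i == ord0) || (b != ord0) ->
      (double_star i b)%:~R = 0 :> 'F_2.
    have two0 : 2%:~R = 0 :> 'F_2 by apply/val_inj.
    rewrite mxE; case: (i == b) => [_|]; first exact: two0.
    case: (i == ord0) => [_|/negbTE-> //].
    by apply/val_inj.
  split=> [k k0|]; apply/matrixP=> a b; rewrite ord1.
    by rewrite -colE mxE reflE [RHS]mxE even ?k0 ?orbT // mulr0 subr0 andbT.
  rewrite -rowE mxE reflE [RHS]mxE eqxx /= (eq_sym b).
  have [i0 | i0] := eqVneq i ord0; first by rewrite even ?i0 // mulr0 subr0.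
  by rewrite mul0r subr0.
- move=> w1 w2 [c1 r1] [c2 r2]; rewrite /fixes_mod2 /mod2 map_mxM.
  split=> [k k0|]; first by rewrite -mulmxA (c2 k k0) c1.
  by rewrite mulmxA r1.
Qed.

Lemma double_star_roots_disjoint (i j : 'I_4) :
  weyl_orbit double_star (simple_root i) =
  weyl_orbit double_star (simple_root j) -> i = j.
Proof.
move=> eq_orbit; apply/eqP/negPn/negP=> ij.
have : weyl_orbit double_star (simple_root i) (simple_root j).
  rewrite eq_orbit; exists 1%:M; first exact: weyl1.
  by rewrite mul1mx.
case=> w /double_star_weyl_mod2 [fix_col fix_row] wij.
have wij2 : mod2 w *m delta_mx i 0 = delta_mx j 0 :> 'cV_4.
  have := congr1 (map_mx (intr : int -> 'F_2)) wij.
  by rewrite map_mxM !map_delta_mx; apply.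
have [i0 | i0] := eqVneq i ord0.
  have /matrixP/(_ 0 0) := congr1 (mulmx (delta_mx 0 ord0 : 'rV_4)) wij2.
  rewrite mulmxA fix_row i0 !mul_delta_mx_cond eqxx !mxE.
  by rewrite -i0 (negbTE ij) mulr0n mxE.
have := wij2; rewrite fix_col // => /matrixP/(_ i 0).
by rewrite !mxE eqxx (negbTE ij).
Qed.

Lemma double_star_orbits : (real_root_orbits double_star #= `I_4)%card.
Proof.
pose f k := weyl_orbit double_star (simple_root (inord k : 'I_4)).
have -> : real_root_orbits double_star = (f @` `I_4)%classic.
  apply/seteqP; split=> [_ [_ [w [i [Ww ->]]] <-]|_ [k _ <-]].
    exists i; first exact: ltn_ord.
    by rewrite /f inord_val weyl_orbit_mulmx //; apply: double_star_gcm.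
  exists (simple_root (inord k)) => //; exists 1%:M, (inord k).
  by split; [apply: weyl1 | rewrite mul1mx].
apply: inj_card_eq => k1 k2 /set_mem lt1 /set_mem lt2.
move=> /double_star_roots_disjoint/(congr1 val).
by rewrite /= !inordK.
Qed.

Local Open Scope classical_set_scope.
Local Open Scope card_scope.

Theorem mainTheorem4 :
  (forall (l : nat) (A : 'M[int]_l),
     hyperbolic A -> real_root_orbits A #<= `I_4) /\
  (exists (l : nat) (A : 'M[int]_l),
     hyperbolic A /\ real_root_orbits A #= `I_4).
Proof.
split=> [l A|]; first exact: hyperbolic_orbits_le4.
by exists 4%N, double_star; split;
  [apply: double_star_hyperbolic | apply: double_star_orbits].
Qed.
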